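(* (In ZFC) There exists a separable metric space $X$ such that $|X|=\omega_1$, $X$ is not $\sigma$-compact, and $X$ has property ${\sf U}_{fin}(\Gamma,\Gamma)$. This $X$ also has property ${\sf S}_1(\Gamma,\Omega)$.
   Context: Throughout, ''cover'' means countable open cover. For a space $X$, a cover $\mathcal{U}$ of $X$ is an $\omega$-cover if $X\notin\mathcal{U}$ and every finite subset of $X$ is contained in some member of $\mathcal{U}$; it is a $\gamma$-cover if $\mathcal{U}$ is infinite and each $x\in X$ fails to belong to only finitely many members of $\mathcal{U}$. $\Omega$ and $\Gamma$ denote the families of $\omega$-covers and $\gamma$-covers of $X$. $X$ has ${\sf S}_1(\Gamma,\Omega)$ if for every sequence $(\mathcal{U}_n)$ of $\gamma$-covers one can choose $U_n\in\mathcal{U}_n$ with $\{U_n:n\in\omega\}$ an $\omega$-cover. $X$ has ${\sf U}_{fin}(\Gamma,\Gamma)$ (the Hurewicz property) if for every sequence $(\mathcal{U}_n)$ of $\gamma$-covers one can choose finite $\mathcal{V}_n\subseteq\mathcal{U}_n$ such that either $\{\bigcup\mathcal{V}_n:n\in\omega\}$ is a $\gamma$-cover of $X$ or $\bigcup\mathcal{V}_n=X$ for some $n$. *)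

(* Defs.v *)
From mathcomp Require Import all_boot all_order all_algebra.
From mathcomp Require Import boolp classical_sets functions cardinality.
From mathcomp Require Import wochoice reals topology.

Set Implicit Arguments.
Unset Strict Implicit.
Unset Printing Implicit Defensive.

Local Open Scope classical_set_scope.
Local Open Scope card_scope.

(* (W, le) has order type omega_1, the least uncountable ordinal: le is the
   reflexive order relation, and proper initial segments, being ordinals
   smaller than omega_1, are countable. *)
Definition order_type_omega1 (W : Type) (le : rel W) : Prop :=
  [/\ well_order le,
      ~ countable [set: W]
    & forall w : W, countable [set v | le v w /\ v <> w]].

Definition card_omega1 (X : Type) : Prop :=
  exists (W : Type) (le : rel W),
    order_type_omega1 le /\ [set: X] #= [set: W].

Section TopologicalNotions.
Variable X : topologicalType.

Definition separable : Prop := exists2 D : set X, countable D & dense D.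

Definition sigma_compact : Prop :=
  exists K : nat -> set X,
    (forall n, compact (K n)) /\ \bigcup_n K n = [set: X].

Definition ctbl_open_cover (U : set (set X)) : Prop :=
  [/\ countable U, (forall A, U A -> open A) & \bigcup_(A in U) A = [set: X]].

Definition Omega : set (set (set X)) :=
  [set U | [/\ ctbl_open_cover U, ~ U [set: X]
             & forall F : set X, finite_set F -> exists2 A, U A & F `<=` A]].

Definition Gamma : set (set (set X)) :=
  [set U | [/\ ctbl_open_cover U, infinite_set U
             & forall x : X, finite_set [set A | U A /\ ~ A x]]].

Definition S1 (P Q : set (set (set X))) : Prop :=
  forall U : nat -> set (set X), (forall n, P (U n)) ->
  exists A : nat -> set X, (forall n, U n (A n)) /\ Q (range A).

Definition Ufin (P Q : set (set (set X))) : Prop :=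
  forall U : nat -> set (set X), (forall n, P (U n)) ->
  exists V : nat -> set (set X),
    (forall n, V n `<=` U n /\ finite_set (V n)) /\
    (Q (range (fun n => \bigcup_(A in V n) A)) \/
     exists n, \bigcup_(A in V n) A = [set: X]).

End TopologicalNotions.

Arguments Omega : clear implicits.
Arguments Gamma : clear implicits.

(* Main.v *)
From HB Require Import structures.
Require Import Defs.
From mathcomp Require Import all_boot all_order all_algebra.
From mathcomp Require Import finmap.
From mathcomp Require Import boolp classical_sets functions cardinality.
From mathcomp Require Import wochoice reals topology.

(* If every family of omega_1 functions nat -> nat is bounded modulo finite
   (omega_1 < b), any subspace of the Cantor space of size omega_1 works: an
   enumeration of the gamma-covers turns each point into a function, and a common
   bound selects a gamma-cover.  Otherwise an unbounded family indexed by omega_1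
   yields a tower (a_w), decreasing modulo finite, with enumerations above the
   given functions, and X consists of the a_w and the finite subsets of nat.
   For every h some a_w has infinitely many gaps [k, h k), and so has every later
   member of the tower at almost all of the same places.  Since, by compactness, an
   open set around the finite subsets of [0, k) contains all points with a suitable
   gap [k, K), a selection along these gaps captures all but countably many points,
   and it can be chosen so late in each cover that it captures those too.
   In both cases X satisfies S_1(Gamma, Gamma), hence the two required properties.
   If X were sigma-compact, some uncountable compact set would contain a closed
   set of size continuum that misses the finite sets: in the first case its size
   contradicts boundedness, in the second case such a closed set is countable. *)

Set Implicit Arguments.
Unset Strict Implicit.
Unset Printing Implicit Defensive.

Import Order.TTheory GRing.Theory Num.Theory.

Local Open Scope classical_set_scope.
Local Open Scope card_scope.

(** * Well-orders of type omega_1 *)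

Section WellOrder.
Variables (W : Type) (le : rel W).
Hypothesis wo : well_order le.

Lemma well_order_min (P : W -> Prop) : (exists w, P w) ->
  exists2 w, P w & forall v, P v -> le w v.
Proof.
case=> w Pw; have [|m [[mP mle] _]] := wo (A := fun v => `[< P v >]).
  by exists w; apply/asboolP.
exists m; first exact/asboolP.
by move=> v Pv; apply: mle; apply/asboolP.
Qed.

Lemma well_order_total v w : le v w \/ le w v.
Proof.
have [|m [->|->] lem] := @well_order_min (fun u => u = v \/ u = w).
- by exists v; left.
- by left; apply: lem; right.
- by right; apply: lem; left.
Qed.

Lemma well_order_anti v w : le v w -> le w v -> v = w.
Proof.
have refl u : le u u by case: (well_order_total u u).
move=> vw wv.
have [|m [_ um]] := wo (A := fun u => `[< u = v \/ u = w >]).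
  by exists v; apply/asboolP; left.
have mE u : u = v \/ u = w -> m = u.
  move=> uvw; apply: um; split; first exact/asboolP.
  by case: uvw => -> x /asboolP[]->.
by rewrite -(mE v (or_introl erefl)) -(mE w (or_intror erefl)).
Qed.

Definition strictly v w := le v w /\ v <> w.

Lemma strictly_trichotomy v w : [\/ strictly v w, v = w | strictly w v].
Proof.
have [->|vw] := pselect (v = w); first exact: Or32.
by have [?|?] := well_order_total v w;
  [apply: Or31 | apply: Or33]; split=> // /esym.
Qed.

Lemma strictly_wf : well_founded strictly.
Proof.
move=> w; apply: contrapT => nw.
have [m nm lem] := well_order_min (ex_intro (fun v => ~ Acc strictly v) w nw).
apply: nm; constructor=> v [vm nvm]; apply: contrapT => /lem mv.
exact/nvm/well_order_anti.
Qed.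

End WellOrder.

Lemma uncountable_cantor : ~ countable [set: nat -> bool].
Proof.
move=> /countable_injP[f finj].
pose D n := `[< exists2 g : nat -> bool, f g = n & ~~ g n >].
have [Df|nDf] := boolP (D (f D)).
  have /asboolP[g fg gD] := Df.
  have gE : g = D by apply: finj; rewrite ?inE.
  by rewrite gE in gD; move/negP: gD; apply.
by move/negP: (nDf); apply; apply/asboolP; exists D.
Qed.

(** Well-order the Cantor space and keep the elements with countably many predecessors. If these
    were countable in number, the least excluded element would have countably many predecessors too.
    The injection [i] turns [W] into a set of points of the Cantor space. *)
Lemma order_type_omega1_exists :
  exists (W : choiceType) (le : rel W) (i : W -> nat -> bool),
    injective i /\ order_type_omega1 le.
Proof.
have [le wo] := well_ordering_principle (nat -> bool).
pose P w := `[< countable [set v | le v w /\ v <> w] >].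
pose W : choiceType := {w | P w}.
exists W, (fun v w => le (val v) (val w)), val.
split; first exact: val_inj.
split.
- move=> A [w Aw].
  pose B u := exists2 v : W, v \in A & val v = u.
  have [|_ [m Am <-] lem] := well_order_min wo (P := B).
    by exists (val w), w.
  exists m; split.
    by split=> // v Av; apply: lem; exists v.
  move=> m' [Am' lem']; apply/val_inj/(well_order_anti wo).
    by apply: lem; exists m'.
  exact: lem'.
- have uP : ~ countable [set w | P w].
    have [all|] := pselect (forall w, P w).
      have -> : [set w | P w] = setT by apply/seteqP; split=> // w _; apply: all.
      exact: uncountable_cantor.
    move=> /existsNP/(well_order_min wo)[m nPm lem].
    move=> cP; apply: nPm; apply/asboolP; apply: sub_countable cP.
    apply: subset_card_le => v [vm nvm] /=.
    by apply: contrapT => /lem mv; apply/nvm/(well_order_anti wo).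
  move=> /countable_injP[f finj]; apply/uP/countable_injP.
  exists (fun u => if insub u is Some w then f w else 0) => u v.
  rewrite !inE /= => Pu Pv; rewrite !insubT => /finj.
  by rewrite !inE => /(_ I I) [].
- move=> w; have /asboolP := valP w.
  move=> /countable_injP[f finj]; apply/countable_injP.
  exists (f \o val) => u v; rewrite !inE /= => -[uw nuw] [vw nvw] fuv.
  by apply/val_inj/finj => //; rewrite inE/=; split=> // /val_inj.
Qed.

(** A copy of [C], ordered by its codes, is placed below [W]. This gives the cardinality of the
    tower space, where [C] is the type of finite sets. *)
Lemma order_type_omega1_sum (C : countType) (W : Type) (le : rel W) :
  order_type_omega1 le ->
  exists le' : rel (C + W), order_type_omega1 le'.
Proof.
move=> [wo uW cW].
pose le' (x y : C + W) := match x, y with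
  | inl c, inl d => (choice.pickle c <= choice.pickle d)%N
  | inl _, inr _ => true
  | inr _, inl _ => false
  | inr v, inr w => le v w end.
exists le'; split.
- apply: antisymmetric_well_order.
    case=> [c|v] [d|w] //=; last by move=> /andP[] /(well_order_anti wo) /[apply]->.
    by move=> /anti_leq/(pcan_inj choice.pickleK)->.
  move=> A [x Ax].
  have [[c Ac]|nA] := pselect (exists c, inl c \in A).
    have ex : exists n, `[< exists2 d, inl d \in A & choice.pickle d = n >].
      by exists (choice.pickle c); apply/asboolP; exists c.
    case: (ex_minnP ex) => _ /asboolP[d Ad <-] mind.
    exists (inl d); split=> // -[c'|w] //= Ac'.
    by apply: mind; apply/asboolP; exists c'.
  case: x Ax => [c Ac|w Aw]; first by case: nA; exists c.
  have [|m Am lem] := well_order_min wo (P := fun w => inr w \in A).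
    by exists w.
  exists (inr m); split=> // -[c Ac|v Av]; first by case: nA; exists c.
  exact: lem.
- apply: contra_not uW => /countable_injP[f finj]; apply/countable_injP.
  by exists (f \o inr) => v w _ _ /finj; rewrite !inE => /(_ I I) [].
- have cC : countable (range (@inl C W)).
    by apply: (card_le_trans (card_image_le _ _)); apply: countableP.
  have cR w : countable ((@inr C W) @` [set v | le v w /\ v <> w]).
    by apply: (card_le_trans (card_image_le _ _)); apply: cW.
  move=> [c|w].
    apply: sub_countable cC; apply: subset_card_le => -[d|v] [] //= _ _.
    by exists d.
  have cU : countable (\bigcup_(b in [set: bool])
      (if b then range (@inl C W) else (@inr C W) @` [set v | le v w /\ v <> w])).
    by apply: bigcup_countable; [apply: countableP | case].
  apply: sub_countable cU; apply: subset_card_le => -[d|v] [] /= vw nvw.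
    by exists true => //; exists d.
  by exists false => //; exists v => //; split=> // vE; apply: nvw; rewrite vE.
Qed.

(** * Towers *)

Lemma countable_enum T (D : set T) : countable D -> D !=set0 ->
  exists s : nat -> T, (forall i, D (s i)) /\ forall x, D x -> exists i, s i = x.
Proof.
move=> /pfcard_geP[->[x//]|[s]] _; exists s; split.
  by move=> i; apply: (@funS _ _ _ _ s).
by move=> x /(@surj _ _ _ _ s)[i _ <-]; exists i.
Qed.

(** For index type omega_1 and [D := setT], the validity of this for every [phi] is the inequality
    omega_1 < b. *)
Definition dominated_mod_finite T (phi : T -> nat -> nat) (D : set T) :=
  exists H : nat -> nat, forall x, D x ->
    exists N, forall n, (N <= n -> phi x n <= H n)%N.

(** The maximum of the first [n + 1] listed functions at [n] bounds each function from its index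
    on. *)
Lemma countable_dominated T (D : set T) (phi : T -> nat -> nat) :
  countable D -> dominated_mod_finite phi D.
Proof.
move=> cD; have [->|/set0P D0] := eqVneq D set0; first by exists (fun=> 0%N).
have [s [_ sD]] := countable_enum cD D0.
exists (fun n => \max_(i < n.+1) phi (s i) n)%N => x /sD[i <-].
exists i => n lein.
by rewrite (bigop.bigmax_sup (Ordinal (lein : i < n.+1)%N)).
Qed.

Definition almost_sub (a b : nat -> bool) :=
  exists N, forall i, (N <= i)%N -> a i -> b i.

Definition infinitely_many (a : nat -> bool) := forall N, exists2 i, (N <= i)%N & a i.

Definition enumerates (e : nat -> nat) (a : nat -> bool) :=
  {homo e : m n / (m < n)%N} /\ forall i, a i <-> exists n, e n = i.

Lemma homo_ltn_ge e : {homo e : m n / (m < n)%N} -> forall n, (n <= e n)%N.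
Proof. by move=> he; elim=> // n IH; apply: (leq_ltn_trans IH); apply: he. Qed.

Lemma enumerates_infinite e a : enumerates e a -> infinitely_many a.
Proof.
by move=> [he ea] N; exists (e N); [exact: homo_ltn_ge | apply/ea; exists N].
Qed.

(** The [n]-th element of [a] is picked from [c 0], ..., [c n] and beyond [g n], so [a] lies in
    [c j] from its [j]-th element on. *)
Lemma pseudo_intersection (c : nat -> nat -> bool) (g : nat -> nat) :
  (forall n N, exists2 i, (N <= i)%N & forall j, (j <= n)%N -> c j i) ->
  exists e a, [/\ enumerates e a, forall n, (g n <= e n)%N
    & forall j, almost_sub a (c j) /\ a <> c j].
Proof.
move=> cP.
have /choice[pick pickP] : forall nN : nat * nat, exists i,
    (nN.2 <= i)%N /\ forall j, (j <= nN.1)%N -> c j i.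
  by move=> [n N]; have [i] := cP n N; exists i.
(* An element of the intersection is skipped at each step, which makes [a]
   different from each [c j]. *)
pose nxt n N := pick (n, maxn (pick (n, N)).+1 (g n)).
pose fix e n := if n is m.+1 then nxt m.+1 (e m).+1 else nxt 0 0.
pose low n := if n is m.+1 then (e m).+1 else 0%N.
have eE n : e n = nxt n (low n) by case: n.
have nxt_gt n N : (pick (n, N) < nxt n N)%N.
  have [/= + _] := pickP (n, maxn (pick (n, N)).+1 (g n)).
  by rewrite geq_max => /andP[].
have e_lt n : (e n < e n.+1)%N.
  rewrite (eE n.+1); apply: leq_trans (nxt_gt _ _).
  have [/= h _] := pickP (n.+1, (e n).+1); exact: leqW h.
have he : {homo e : m n / (m < n)%N} by apply: homo_ltn => //; exact: ltn_trans.
exists e, (fun i => `[< exists n, e n = i >]); split.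
- by split=> // i; split=> /asboolP.
- move=> n; rewrite eE; have [/= + _] := pickP (n, maxn (pick (n, low n)).+1 (g n)).
  by rewrite geq_max => /andP[].
move=> j; split.
  exists (e j) => i + /asboolP[n eni]; rewrite -eni leqNgt => enj.
  rewrite eE; have [_ /= ->//] := pickP (n, maxn (pick (n, low n)).+1 (g n)).
  by rewrite leqNgt; apply: contra enj => /he.
pose t := pick (j.+1, (e j).+1); have [/= et ct] := pickP (j.+1, (e j).+1).
move=> aE; have : c j t by apply: ct.
rewrite -aE => /asboolP[n ent].
have [nj|jn] := leqP n j.
  have := ltnW_homo he; move: et; rewrite -/t -ent ltnNge => /negP h he'.
  exact/h/he'.
have : (t < e j.+1)%N by rewrite (eE j.+1); apply: nxt_gt.
by rewrite -ent ltnNge (ltnW_homo he).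
Qed.

Section Tower.
Variables (W : Type) (le : rel W).
Hypothesis omega1 : order_type_omega1 le.

Let wo : well_order le. Proof. by case: omega1. Qed.
Let lt := strictly le.

Lemma tower_step (w : W) (a : W -> nat -> bool) (g : nat -> nat) :
  (forall v, lt v w -> infinitely_many (a v)) ->
  (forall u v, lt u v -> lt v w -> almost_sub (a v) (a u)) ->
  exists e b, [/\ enumerates e b, forall n, (g n <= e n)%N
    & forall v, lt v w -> almost_sub b (a v) /\ b <> a v].
Proof.
move=> ainf asub.
have [D0|/set0P D0] := eqVneq [set v | lt v w] set0.
  have [|e [b [eb ge _]]] := @pseudo_intersection (fun _ _ => true) g.
    by move=> n N; exists N.
  by exists e, b; split=> // v vw; have : set0 v by rewrite -D0.
have cD : countable [set v | lt v w] by case: omega1 => _ _; apply.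
have [s [sD Ds]] := countable_enum cD D0.
have [|e [b [eb ge ba]]] := @pseudo_intersection (fun j => a (s j)) g; last first.
  by exists e, b; split=> // v /Ds[i <-]; apply: ba.
(* Finitely many predecessors form a chain modulo finite; the latest one, [s m], is almost contained
   in the others. As it is infinite, it supplies common elements beyond any bound. *)
have subs n : exists m, forall j, (j <= n)%N -> almost_sub (a (s m)) (a (s j)).
  elim: n => [|n [m mP]].
    by exists 0 => j; rewrite leqn0 => /eqP->; exists 0.
  have sub_refl b : almost_sub b b by exists 0.
  have [mn|nm] : almost_sub (a (s m)) (a (s n.+1)) \/
                 almost_sub (a (s n.+1)) (a (s m)).
    have [h|<-|h] := strictly_trichotomy wo (s m) (s n.+1).
    - by right; apply: asub => //; apply: sD.
    - by left.
    - by left; apply: asub => //; apply: sD.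
  - exists m => j; rewrite leq_eqVlt => /predU1P[->//|]; exact: mP.
  - exists n.+1 => j; rewrite leq_eqVlt => /predU1P[->//|/mP[N1 N1P]].
    have [N2 N2P] := nm; exists (maxn N1 N2) => i; rewrite geq_max => /andP[h1 h2].
    by move=> /(N2P _ h2) /(N1P _ h1).
move=> n N; have [m mP] := subs n.
have [M MP] : exists M, forall i, (M <= i)%N -> a (s m) i ->
    forall j, (j <= n)%N -> a (s j) i.
  elim: {-2}n (leqnn n) => [|k IH] kn.
    have [M MP] := mP 0%N isT; exists M => i Mi ai j; rewrite leqn0 => /eqP->.
    exact: MP.
  have [M1 M1P] := IH (ltnW kn); have [M2 M2P] := mP _ kn.
  exists (maxn M1 M2) => i; rewrite geq_max => /andP[h1 h2] ai j.
  by rewrite leq_eqVlt => /predU1P[->|]; [apply: M2P|apply: M1P].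
have [i] := ainf _ (sD m) (maxn N M); rewrite geq_max => /andP[Ni Mi] ai.
by exists i => // j; apply: MP.
Qed.

Lemma tower_exists (f : W -> nat -> nat) :
  exists a : W -> nat -> bool,
    (forall v w, lt v w -> almost_sub (a w) (a v) /\ a w <> a v) /\
    forall w, exists2 e, enumerates e (a w) & forall n, (f w n <= e n)%N.
Proof.
pose good w (c : forall v, lt v w -> nat -> bool) b :=
  (exists2 e, enumerates e b & forall n, (f w n <= e n)%N) /\
  (forall v (h : lt v w), almost_sub b (c v h) /\ b <> c v h).
(* Transfinite recursion: choose a good set if there is one. The default is never taken, since
   [tower_step] provides a good set once all predecessors are good. *)
pose F w (c : forall v, lt v w -> nat -> bool) :=
  xget (fun=> false) [set b | good w c b].
pose a := Fix (strictly_wf wo) (fun=> nat -> bool) F.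
have aE w : a w = F w (fun v _ => a v).
  apply: Fix_eq => {}w c d cd; congr F.
  by apply: functional_extensionality_dep => v; apply/funext => h; apply: cd.
suff aP w : good w (fun v _ => a v) (a w).
  by exists a; split=> [v w vw|w]; have [h1 h2] := aP w; [exact: h2|].
elim/(well_founded_ind (strictly_wf wo)): w => w IH.
have [|u v uv vw|e [b [eb fe ba]]] := @tower_step w a (f w).
- by move=> v /IH[[e /enumerates_infinite]].
- by have [_ /(_ _ uv)[]] := IH _ vw.
rewrite aE; apply: (@xgetPex _ (fun=> false) [set b | good w _ b]).
by exists b; split=> //; exists e.
Qed.

Lemma iter_nondecr h (hmono : {homo h : m n / (m <= n)%N}) n :
  {homo iter n h : k m / (k <= m)%N}.
Proof. by elim: n => // n IH k m km /=; apply/hmono/IH. Qed.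

Lemma iter_above h (hinc : forall n, (n < h n)%N) n N : (N <= iter n h N)%N.
Proof. by elim: n => //= n IH; apply: (leq_trans IH); exact/ltnW/hinc. Qed.

(* If [a w] met every late interval [k, h k), its enumeration, hence [f w],
   would be dominated by iterates of [h]. *)
Lemma unbounded_gaps (f : W -> nat -> nat) (a : W -> nat -> bool) :
  ~ dominated_mod_finite f setT ->
  (forall w, exists2 e, enumerates e (a w) & forall n, (f w n <= e n)%N) ->
  forall h : nat -> nat, exists w, forall N, exists2 k, (N <= k)%N &
    forall i, (k <= i < h k)%N -> ~~ a w i.
Proof.
move=> unb aP h0.
(* A monotone majorant of [h0] lying above the identity, so that iterates can be compared. *)
pose h k := (\max_(i < k.+1) maxn (h0 i) i.+1)%N.
have hmono : {homo h : m n / (m <= n)%N}.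
  move=> m n mn; apply/bigmax_leqP => i _.
  by rewrite (bigop.bigmax_sup (widen_ord (mn : m.+1 <= n.+1)%N i)).
have hge k : (maxn (h0 k) k.+1 <= h k)%N by rewrite (bigop.bigmax_sup ord_max).
have hinc k : (k < h k)%N by apply: leq_trans (hge k); rewrite leq_max leqnn orbT.
apply: contrapT => /forallNP noW; apply: unb.
(* The threshold [N] below depends on [w]. Starting the iteration at [n], which is eventually above
   [N], gives one bound for all [w]. *)
exists (fun n => iter n.+1 h n) => w _.
have /existsNP[N NP] := noW w.
have meets k : (N <= k)%N -> exists2 i, (k <= i < h k)%N & a w i.
  move=> Nk; apply: contrapT => nk; apply: NP; exists k => // i /andP[ki ik].
  apply/negP => ai; apply: nk; exists i => //; rewrite ki.
  by apply: (leq_trans ik); apply: leq_trans (hge k); rewrite leq_max leqnn.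
have [e [he ea] fe] := aP w.
have eb n : (e n < iter n.+1 h N)%N.
  elim: n => [|n IH].
    have [i /andP[_ ih] /ea[n en]] := meets N (leqnn N).
    by apply: leq_ltn_trans ih; rewrite -en (ltnW_homo he).
  have [i /andP[ki ih] /ea[m em]] := meets _ (iter_above hinc n.+1 N).
  apply: leq_ltn_trans ih; rewrite -em (ltnW_homo he)//.
  have := leq_trans IH ki; rewrite -em; apply: contraTT.
  rewrite -!leqNgt; exact: ltnW_homo he _ _.
exists N => n Nn; apply: leq_trans (fe n) _.
by apply: (leq_trans (ltnW (eb n))); apply: iter_nondecr.
Qed.

End Tower.

(** * Subspaces of the Cantor space *)

(** The topology of [X] is the one induced by [e] from the Cantor space. *)
Definition cylinder_nbhs (X : topologicalType) (e : X -> nat -> bool) :=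
  forall x A, nbhs x A <->
    exists n, forall y, (forall i, (i < n)%N -> e y i = e x i) -> A y.

Section FirstDifferenceMetric.
Local Open Scope ring_scope.
Variables (R : realType) (T : choiceType) (e : T -> nat -> bool).
Hypothesis einj : injective e.

Variant diff_spec (x y : T) : R -> Prop :=
| DiffEq of x = y : diff_spec x y 0
| DiffAt n of (forall i, (i < n)%N -> e x i = e y i) & e x n != e y n :
    diff_spec x y n.+1%:R^-1.

Lemma diff_exists x y : exists d, diff_spec x y d.
Proof.
have [->|xy] := eqVneq x y; first by exists 0; constructor.
have ex : exists n, e x n != e y n.
  apply: contrapT => /forallNP h; case/eqP: xy; apply/einj/funext => n.
  by apply/eqP/negPn/negP/h.
case: (ex_minnP ex) => n xyn min_n; exists n.+1%:R^-1; constructor=> //.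
by move=> i; apply: contraTeq => /min_n; rewrite -leqNgt.
Qed.

Definition diff_dist x y := projT1 (cid (diff_exists x y)).

Lemma diff_distP x y : diff_spec x y (diff_dist x y).
Proof. by rewrite /diff_dist; case: cid. Qed.

Lemma diff_dist_xx x : diff_dist x x = 0.
Proof. by case: diff_distP => // n _; rewrite eqxx. Qed.

Lemma diff_dist_eq0 x y : diff_dist x y = 0 -> x = y.
Proof.
case: diff_distP => // n _ _ /eqP; by rewrite invr_eq0 pnatr_eq0.
Qed.

Lemma diff_dist_ge x y n : e x n != e y n -> n.+1%:R^-1 <= diff_dist x y.
Proof.
case: diff_distP => [->|m mP _ nP]; first by rewrite eqxx.
rewrite lef_pV2 ?posrE// ler_nat ltnS leqNgt; apply/negP => /mP /eqP.
exact/negP.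
Qed.

Lemma diff_dist_ge0 x y : 0 <= diff_dist x y.
Proof. by case: diff_distP => // n _ _; rewrite invr_ge0 ler0n. Qed.

Lemma diff_dist_sym x y : diff_dist x y = diff_dist y x.
Proof.
wlog suff le : x y / diff_dist x y <= diff_dist y x.
  by apply/eqP; rewrite eq_le !le.
case: (diff_distP x y) => [->|n _ xyn]; first exact: diff_dist_ge0.
by apply: diff_dist_ge; rewrite eq_sym.
Qed.

(** Where [x] and [z] first differ, [y] differs from one of them, so a single summand already
    suffices. *)
Lemma diff_dist_triangle y x z : diff_dist x z <= diff_dist x y + diff_dist y z.
Proof.
case: (diff_distP x z) => [_|n _ xzn]; first by rewrite addr_ge0 ?diff_dist_ge0.
have [xy|xy] := eqVneq (e x n) (e y n).
  by rewrite ler_wpDl ?diff_dist_ge0//; apply: diff_dist_ge; rewrite -xy.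
by rewrite ler_wpDr ?diff_dist_ge0//; apply: diff_dist_ge.
Qed.

Definition first_difference_space : Type := T.
HB.instance Definition _ := Choice.on first_difference_space.
HB.instance Definition _ := @isMetric.Build R first_difference_space diff_dist
  diff_dist_xx diff_dist_eq0 diff_dist_sym diff_dist_triangle.

Lemma cantor_metric : exists (X : metricType R) (phi : X -> T),
  bijective phi /\ cylinder_nbhs (e \o phi).
Proof.
pose X : metricType R := first_difference_space.
exists X, id; split; first by exists id.
have ballE (x y : X) r : ball x r y = (diff_dist x y < r) :> Prop by [].
move=> x A; split.
  move=> /nbhs_ballP[r /= r0 rA].
  (* Agreement on this many coordinates puts the first difference at some [n] above [r^-1], hence
     the distance below [r]. *)
  exists (Num.truncn r^-1).+1 => y xy; apply: rA; rewrite ballE.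
  case: diff_distP => // n nP nd.
  have rn : (Num.truncn r^-1 < n)%N.
    rewrite ltnNge; apply: contra nd => h; rewrite eq_sym; apply/eqP; exact: xy.
  rewrite invf_plt ?posrE// (lt_le_trans (truncnS_gt _))//.
  by rewrite ler_nat ltnW.
move=> [n nA]; apply/nbhs_ballP; exists n.+1%:R^-1 => /=; first by rewrite invr_gt0.
move=> y; rewrite ballE => xy; apply: nA => i iltn; apply/eqP; rewrite eq_sym.
apply: contraTT xy => /diff_dist_ge le; rewrite -leNgt (le_trans _ le)//.
by rewrite lef_pV2 ?posrE// ler_nat ltnS ltnW.
Qed.

End FirstDifferenceMetric.

(** * Selections from gamma-covers *)

Section GammaSelection.
Variable X : topologicalType.
Implicit Types (x : X) (A : nat -> set X).

Definition eventually_contain A := forall x, exists N, forall n, (N <= n)%N -> A n x.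

(* This is S_1(Gamma, Gamma), with the gamma-covers enumerated. *)
Definition gamma_selection := forall B : nat -> nat -> set X,
  (forall n i, open (B n i)) -> (forall n, eventually_contain (B n)) ->
  exists p : nat -> nat, eventually_contain (fun n => B n (p n)).

Lemma finite_set_uniform_bound T (D : set T) (P : T -> nat -> Prop) :
  finite_set D -> (forall t, D t -> exists N, forall n, (N <= n)%N -> P t n) ->
  exists N, forall n, (N <= n)%N -> forall t, D t -> P t n.
Proof.
elim/Pchoice: T => T in D P *.
move=> /finite_seqP[s ->]; elim: s => [|t s IH] sP.
  by exists 0.
have [|N1 N1P] := IH; first by move=> u us; apply: sP; rewrite /= inE us orbT.
have [|N2 N2P] := sP t; first by rewrite /= inE eqxx.
exists (maxn N1 N2) => n; rewrite geq_max => /andP[h1 h2] u /=.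
by rewrite inE => /predU1P[->|]; [apply: N2P|apply: N1P].
Qed.

(** An injective sequence of members omits each point only finitely often. The whole space is
    discarded first, as an omega-cover must not contain it. *)
Lemma Gamma_enum (U : set (set X)) : Gamma X U ->
  exists A, [/\ forall n, U (A n), forall n, A n <> setT & eventually_contain A].
Proof.
move=> [_ Uinf Ufin].
have : infinite_set (U `\` [set setT]) by apply: infinite_setD.
move=> /infiniteP/pcard_leP[f].
have fU n : (U `\` [set setT]) (f n) by apply: (@funS _ _ _ _ f).
exists f; split; [by move=> n; case: (fU n)..|].
move=> x; have /finite_set_uniform_bound := finite_preimage
  (f := f) (fun m n _ _ => @inj _ _ _ f m n (mem_set I) (mem_set I)) (Ufin x).
move=> /(_ (fun m n => (m < n)%N))[|N NP].
  by move=> m _; exists m.+1.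
exists N => n Nn; apply: contrapT => nx; have := NP _ Nn n (conj (proj1 (fU n)) nx).
by rewrite ltnn.
Qed.

(** The range is infinite because each [A m] omits a point that all late [A n] contain: if there
    were finitely many values, some late one would differ from all of them. *)
Lemma Gamma_range A : (forall n, open (A n)) -> (forall n, A n <> setT) ->
  eventually_contain A -> Gamma X (range A).
Proof.
move=> Aop AT Aev; split.
- split.
  + by apply: (card_le_trans (card_image_le _ _)); apply: countableP.
  + by move=> _ [n _ <-].
  + apply/seteqP; split=> // x _; have [N NP] := Aev x.
    by exists (A N); [exists N | apply: NP].
- move=> fin.
  have [|N /(_ N (leqnn N) (A N))] :=
    @finite_set_uniform_bound _ _ (fun M n => M <> A n) fin.
    move=> _ [m _ <-].
    have /existsNP[x xm] : ~ forall x, A m x.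
      by move=> h; apply: (AT m); apply/seteqP; split=> // x _; apply: h.
    have [N NP] := Aev x; exists N => n /NP xn mn; apply: xm; by rewrite mn.
  by move=> h; apply: h => //; exists N.
- move=> x; have [N NP] := Aev x.
  apply: sub_finite_set (finite_image A (finite_II N)) => _ [[n _ <-] nx].
  by exists n => //=; rewrite ltnNge; apply/negP => /NP.
Qed.

Lemma Omega_range A : (forall n, open (A n)) -> (forall n, A n <> setT) ->
  eventually_contain A -> Omega X (range A).
Proof.
move=> Aop AT Aev; have [cov _ _] := Gamma_range Aop AT Aev; split=> //.
  by move=> [n _ /AT].
move=> F Ffin.
have [|N NP] := @finite_set_uniform_bound _ F (fun x n => A n x) Ffin.
  by move=> x _; apply: Aev.
by exists (A N); [exists N | move=> x; apply: NP].
Qed.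

Lemma gamma_selection_cover (U : nat -> set (set X)) : gamma_selection ->
  (forall n, Gamma X (U n)) -> exists A,
  [/\ forall n, U n (A n), forall n, open (A n), forall n, A n <> setT
    & eventually_contain A].
Proof.
move=> sel UG.
have /choice[B BP] n := Gamma_enum (UG n).
have Uop n i : open (B n i).
  by have [[_ +_] _ _] := UG n; apply; case: (BP n).
have [|p pP] := sel B Uop; first by move=> n; case: (BP n).
by exists (fun n => B n (p n)); split=> // n; case: (BP n).
Qed.

Lemma gamma_selection_Ufin : gamma_selection -> Ufin (Gamma X) (Gamma X).
Proof.
move=> sel U /(gamma_selection_cover sel)[A [AU Aop AT Aev]].
exists (fun n => [set A n]); split.
  by move=> n; split; [move=> _ ->|exact: finite_set1].
left; rewrite (_ : (fun n => _) = A); first exact: Gamma_range.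
by apply/funext => n; rewrite bigcup_set1.
Qed.

Lemma gamma_selection_S1 : gamma_selection -> S1 (Gamma X) (Omega X).
Proof.
move=> sel U /(gamma_selection_cover sel)[A [AU Aop AT Aev]].
by exists A; split=> //; apply: Omega_range.
Qed.

End GammaSelection.

(** * Perfect subsets *)

Section CylinderSpace.
Variables (X : topologicalType) (e : X -> nat -> bool).
Hypotheses (einj : injective e) (enbhs : cylinder_nbhs e).

Lemma cylinder_separable : separable X.
Proof.
have [x0|noX] := pselect (exists x : X, True); last first.
  exists set0; first exact: countable0.
  by move=> O [x _]; case: noX; exists x.
case: x0 => x0 _.
(* One point for each finite prefix that occurs; other prefixes receive the default [x0]. *)
pose pick (s : seq bool) :=
  xget x0 [set x | forall i, (i < size s)%N -> e x i = nth false s i].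
exists (range pick).
  by apply: (card_le_trans (card_image_le _ _)); apply: countableP.
move=> O [x Ox] Oop.
have /enbhs[n nO] : nbhs x O by apply: open_nbhs_nbhs.
exists (pick (mkseq (e x) n)); split; last by eexists.
apply: nO => i lein.
have : [set y | forall i, (i < size (mkseq (e x) n))%N ->
    e y i = nth false (mkseq (e x) n) i] (pick (mkseq (e x) n)).
  by apply: xgetPex; exists x => j; rewrite size_mkseq => jn; rewrite nth_mkseq.
by move=> /(_ i); rewrite size_mkseq nth_mkseq// => ->.
Qed.

Lemma closed_coordinate i b : closed [set x | e x i = b].
Proof.
move=> x clx; have [|y [/= <- /= ->//]] := clx [set y | e y i = e x i].
by apply/enbhs; exists i.+1 => y h /=; apply: h.
Qed.

(** Otherwise each coordinate [i] has a value [b i] taken only countably often in [C]. Any two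
    points avoiding every [b i] agree everywhere, so [C] would be countable. *)
Lemma uncountable_split (C : set X) : ~ countable C ->
  exists i, forall b, ~ countable (C `&` [set x | e x i = b]).
Proof.
move=> uC; apply: contrapT => /forallNP nosplit; apply: uC.
have /choice[b bP] i : exists b, countable (C `&` [set x | e x i = b]).
  by have /existsNP[b /contrapT] := nosplit i; exists b.
pose D (o : option nat) := if o is Some i then C `&` [set x | e x i = b i]
  else [set x | forall i, e x i <> b i].
have cD : countable (\bigcup_(o in setT) D o).
  apply: bigcup_countable; first exact: countableP.
  move=> [i|] _ //=; apply/countable_injP; exists (fun=> 0%N) => x y.
  rewrite !inE /= => xb yb _; apply/einj/funext => i.
  by move: (xb i) (yb i); case: (e x i); case: (e y i); case: (b i).
apply: sub_countable cD; apply: subset_card_le => x Cx.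
have [[i ei]|/forallNP h] := pselect (exists i, e x i = b i).
  by exists (Some i).
by exists None.
Qed.

(** A first split yields an uncountable half differing from [q] in a coordinate; a second split cuts
    that half in two. *)
Lemma uncountable_closed_split (C : set X) (q : X) :
  closed C -> ~ countable C ->
  exists C' : bool -> set X,
    (forall b, [/\ C' b `<=` C, closed (C' b), ~ countable (C' b) & ~ C' b q]) /\
    forall b c x, C' b x -> C' c x -> b = c.
Proof.
move=> clC /uncountable_split[i /(_ (~~ e q i))/uncountable_split[j uC]].
exists (fun b => C `&` [set x | e x i = ~~ e q i] `&` [set x | e x j = b]).
split=> [b|b c x [_ <-] [_ <-]//]; split=> //.
- by move=> x [[]].
- by apply: closedI; [apply: closedI|]; [|exact: closed_coordinate..].
- by move=> [[_ /= + _]]; case: (e q i).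
Qed.

(** A Cantor scheme of closed uncountable sets, with [F] the intersection of the unions of its
    levels. Level [n + 1] avoids [q n], and each branch contributes a point. *)
Lemma perfect_subset (K : set X) (q : nat -> X) :
  compact K -> closed K -> ~ countable K ->
  exists F, [/\ closed F, F `<=` K, forall n, ~ F (q n)
    & exists g : (nat -> bool) -> X, injective g /\ forall f, F (g f)].
Proof.
move=> coK clK uK.
have /choice[sp spP] (nC : nat * set X) : exists C' : bool -> set X,
    closed nC.2 -> ~ countable nC.2 ->
    (forall b, [/\ C' b `<=` nC.2, closed (C' b), ~ countable (C' b)
                 & ~ C' b (q nC.1)]) /\
    forall b c x, C' b x -> C' c x -> b = c.
  case: nC => n C /=.
  have [clC|] := pselect (closed C); last by exists (fun=> set0).
  have [|uC] := pselect (countable C); first by exists (fun=> set0).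
  by have [C' ?] := uncountable_closed_split (q n) clC uC; exists C'.
(* The newest bit is at the head, and [size s'] tells which point of [q] the next split must
   avoid. *)
pose fix D (s : seq bool) :=
  if s is b :: s' then sp (size s', D s') b else K.
have DP s : closed (D s) /\ ~ countable (D s).
  elim: s => [//|b s [clD uD]] /=.
  by have [/(_ b)[]] := spP (size s, D s) clD uD.
have DS b s : D (b :: s) `<=` D s.
  by have [clD uD] := DP s; have [/(_ b)[]] := spP (size s, D s) clD uD.
pose L n := \bigcup_(t in [set: n.-tuple bool]) D t.
exists (\bigcap_n L n); split.
- apply: closed_bigI => n _; apply: closed_bigcup; first exact: finite_finset.
  by move=> t _; case: (DP t).
- by move=> x /(_ 0%N I)[t _]; rewrite tuple0.
- move=> n /(_ n.+1 I)[t _]; case/tupleP: t => b t /=; rewrite size_tuple.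
  by have [clD uD] := DP t; have [/(_ b)[]] := spP (n, D t : set X) clD uD.
pose fix pre (f : nat -> bool) n := if n is m.+1 then f m :: pre f m else [::].
have size_pre f n : size (pre f n) = n by elim: n => //= n ->.
have preS f m n : (m <= n)%N -> D (pre f n) `<=` D (pre f m).
  elim: n => [|n IH]; first by rewrite leqn0 => /eqP->.
  by rewrite leq_eqVlt => /predU1P[->//|/IH h]; apply: subset_trans h; apply: DS.
have /choice[g gP] f : exists x, forall n, D (pre f n) x.
  have /choice[u uP] n : exists x, D (pre f n) x.
    apply: contrapT => /forallNP h; have [_] := DP (pre f n); apply.
    have -> : D (pre f n) = set0 by rewrite -subset0 => x /h.
    exact: countable0.
  (* A cluster point of the [u n] lies in every set of the branch, since these sets are closed and
     decreasing. *)
  have [|x [_ clx]] := coK (u @ \oo) _.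
    by exists 0%N => // n _; apply: (preS f 0%N n).
  exists x => n; have [+ _] := DP (pre f n); apply=> B xB.
  have [|y [Dy By]] := clx (D (pre f n)) B _ xB; last by exists y.
  by exists n => // m /= nm; apply: preS nm _ _.
exists g; split=> [f1 f2 f12|f n _]; last first.
  by exists (Tuple (introT eqP (size_pre f n))) => //=.
have eqf n : pre f1 n = pre f2 n -> f1 n = f2 n.
  move=> e12; have := gP f1 n.+1; have := gP f2 n.+1; rewrite -f12 /= -e12.
  have [clD uD] := DP (pre f1 n).
  have [_ dis] := spP (size (pre f1 n), D (pre f1 n)) clD uD.
  by move=> h2 h1; apply: dis h1 h2.
have eqp n : pre f1 n = pre f2 n by elim: n => //= n IH; rewrite IH (eqf n).
by apply/funext => n; apply: eqf.
Qed.

End CylinderSpace.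

(** * The two cases *)

(** Coding functions by their graphs, an injective [g] would embed [nat -> nat] into [W]. The
    decoding family then contains every function, but no [H] dominates [H + 1]. *)
Lemma dominated_no_cantor_injection (W : Type) (g : (nat -> bool) -> W) :
  (forall f : W -> nat -> nat, dominated_mod_finite f setT) -> ~ injective g.
Proof.
move=> dom ginj.
pose code (f : nat -> nat) m :=
  if choice.unpickle m is Some (i, j) then f i == j else false.
have code_inj : injective code.
  move=> f f' ff'; apply/funext => i; apply/esym/eqP.
  have : code f (choice.pickle (i, f i)) by rewrite /code choice.pickleK.
  by rewrite ff' /code choice.pickleK.
have /choice[f fP] w : exists h : nat -> nat, forall h', g (code h') = w -> h' = h.
  have [[h hw]|nh] := pselect (exists h, g (code h) = w).
    by exists h => h'; rewrite -hw => /ginj/code_inj.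
  by exists id => h hw; case: nh; exists h.
have [H HP] := dom f.
have [N NP] := HP (g (code (fun n => (H n).+1))) I.
have := NP N (leqnn N).
by rewrite -(fP _ (fun n => (H n).+1) erefl) ltnn.
Qed.

Lemma dominated_gamma_selection (X : topologicalType) :
  (forall f : X -> nat -> nat, dominated_mod_finite f setT) ->
  gamma_selection X.
Proof.
move=> dom B _ Bev.
have /choice[f fP] x : exists f : nat -> nat,
    forall n i, (f n <= i)%N -> B n i x.
  by have /choice[f fP] n := Bev n x; exists f.
have [p pP] := dom f; exists p => x; have [N NP] := pP x I.
by exists N => n Nn; apply/fP/NP.
Qed.

Lemma sigma_compact_uncountable (X : topologicalType) :
  ~ countable [set: X] -> sigma_compact X ->
  exists2 K : set X, compact K & ~ countable K.
Proof.
move=> uX [K [coK KX]]; apply: contrapT => noK; apply: uX.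
rewrite -KX; apply: bigcup_countable => [|n _]; first exact: countableP.
by apply: contrapT => uK; apply: noK; exists (K n).
Qed.

Lemma dominated_not_sigma_compact (X : topologicalType) (e : X -> nat -> bool) :
  injective e -> cylinder_nbhs e -> hausdorff_space X -> ~ countable [set: X] ->
  (forall f : X -> nat -> nat, dominated_mod_finite f setT) ->
  ~ sigma_compact X.
Proof.
move=> einj enbhs hX uX dom /(sigma_compact_uncountable uX)[K coK uK].
have [x0 _] : K !=set0.
  by apply/set0P/eqP => K0; apply: uK; rewrite K0; apply: countable0.
have [F [_ _ _ [g [ginj _]]]] := perfect_subset einj enbhs (fun=> x0) coK
  (compact_closed hX coK) uK.
exact: dominated_no_cantor_injection dom ginj.
Qed.

(** * The second case: the space of a tower and the finite sets *)

Section TowerSpace.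
Variables (W : Type) (le : rel W) (a : W -> nat -> bool).
Hypothesis omega1 : order_type_omega1 le.
Let lt := strictly le.
Hypothesis tower : forall v w, lt v w -> almost_sub (a w) (a v) /\ a w <> a v.
Hypothesis tower_inf : forall w, infinitely_many (a w).
Hypothesis tower_gaps : forall h : nat -> nat, exists w,
  forall N, exists2 k, (N <= k)%N & forall i, (k <= i < h k)%N -> ~~ a w i.

Definition tower_code (x : {fset nat} + W) : nat -> bool :=
  match x with inl s => fun i => i \in s | inr w => a w end.

Lemma tower_code_inj : injective tower_code.
Proof.
have fset_neq (s : {fset nat}) w : (fun i => i \in s) <> a w.
  move=> sw; have [i] := tower_inf w (\max_(j <- s) j).+1.
  by rewrite -sw ltnNge => /negP + si; apply; apply: leq_bigmax_seq.
case: omega1 => wo _ _ [s|v] [t|w] /=.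
- by move=> st; congr inl; apply/fsetP => i; have := congr1 (@^~ i) st.
- by move=> /fset_neq.
- by move=> /esym/fset_neq.
- have [vw|->//|wv] := strictly_trichotomy wo v w.
    by move=> avw; case: (tower vw) => _ /(_ (esym avw)).
  by move=> avw; case: (tower wv).
Qed.

Variables (X : topologicalType) (phi : X -> {fset nat} + W).
Hypothesis phi_bij : bijective phi.
Let e := tower_code \o phi.
Hypothesis enbhs : cylinder_nbhs e.

Definition finite_points : set X := [set x | exists s, phi x = inl s].

(** Only finitely many finite sets lie below [k], so their individual thresholds have a common
    bound. *)
Lemma finite_points_prefix k (G : nat -> set X) :
  (forall x, finite_points x -> exists N, forall n, (N <= n)%N -> G n x) ->
  exists N, forall n, (N <= n)%N -> forall x, finite_points x ->
    (forall i, (k <= i)%N -> ~~ e x i) -> G n x.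
Proof.
move=> GP; have [psi phiK psiK] := phi_bij.
pose D := range (fun r : k.-tuple bool =>
  psi (inl [fset i in iota 0 k | nth false r i]%fset)).
have [||N NP] := @finite_set_uniform_bound _ D (fun x n => G n x).
- by apply: finite_image; apply: finite_finset.
- by move=> _ [r _ <-]; apply: GP; eexists; rewrite psiK.
exists N => n Nn x [s xs] x0; apply: NP => //.
exists [tuple of mkseq (mem s) k] => //.
apply: (can_inj phiK); rewrite psiK xs; congr inl; apply/fsetP => i.
rewrite !inE mem_iota /= add0n.
have [ik|ki] /= := ltnP i k.
  by rewrite nth_mkseq.
by have := x0 i ki; rewrite /e /= xs /= => /negbTE.
Qed.

(* The compactness argument of Galvin and Miller: only finitely many prefixes
   of length [k] occur. *)
Lemma gap_neighbourhood k (G : set X) :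
  (forall x, finite_points x -> (forall i, (k <= i)%N -> ~~ e x i) -> nbhs x G) ->
  exists K, forall x, (forall i, (k <= i < K)%N -> ~~ e x i) -> G x.
Proof.
move=> GP; have [psi phiK psiK] := phi_bij.
(* With [Q], the uniform threshold [K] is a cylinder length. A point with gap [k, K) agrees on the
   first [K] coordinates with its truncation to [0, k), which is a finite point. *)
pose Q n x := (forall i, (k <= i)%N -> ~~ e x i) ->
  forall y, (forall i, (i < n)%N -> e y i = e x i) -> G y.
have [|K KP] := @finite_points_prefix k Q.
  move=> x fx; have [x0|] := pselect (forall i, (k <= i)%N -> ~~ e x i);
    last by
    move=> nx0; exists 0%N => n _ /nx0.
  have /enbhs[N NP] := GP x fx x0; exists N => n Nn _ y yx.
  by apply: NP => i iN; apply: yx; apply: leq_trans Nn.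
exists K => x xK.
pose s := [fset i in iota 0 k | e x i]%fset.
have es i : e (psi (inl s)) i = (i < k)%N && e x i.
  by rewrite /e /= psiK /= !inE mem_iota.
have s0 i : (k <= i)%N -> ~~ e (psi (inl s)) i by move=> ki; rewrite es ltnNge ki.
apply: (KP K (leqnn K) (psi (inl s))) => //; first by exists s; rewrite psiK.
move=> i iK; rewrite es; have [//|ki] /= := ltnP i k.
by apply/negbTE/xK; rewrite ki.
Qed.

(** These are the points that need not inherit the gaps of [a w0]. *)
Lemma countable_initial w0 :
  countable (finite_points `|`
    [set x | exists2 w, ~ lt w0 w & phi x = inr w]).
Proof.
have [psi phiK psiK] := phi_bij; have [wo _ cW] := omega1.
have : countable (\bigcup_(o in [set: option (option {fset nat})])
    (match o with
     | Some (Some s) => [set psi (inl s)]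
     | Some None => [set psi (inr w0)]
     | None => (psi \o inr) @` [set v | le v w0 /\ v <> w0] end)).
  apply: bigcup_countable => [|[[s|]|] _]; [exact: countableP|exact: countable1..|].
  by apply: (card_le_trans (card_image_le _ _)); apply: cW.
apply: sub_countable; apply: subset_card_le => x [[s xs]|[w w0w xw]].
  by exists (Some (Some s)) => //=; rewrite -xs phiK.
have [?|ww0|?] := strictly_trichotomy wo w w0; last by [].
  by exists None => //=; exists w => //=; rewrite -xw phiK.
by exists (Some None) => //=; rewrite -ww0 -xw phiK.
Qed.

Lemma initial_or_later_point w0 x :
  (finite_points `|` [set x | exists2 w, ~ lt w0 w & phi x = inr w]) x \/
  exists2 w, lt w0 w & phi x = inr w.
Proof.
case E : (phi x) => [s|w]; first by left; left; exists s.
by have [?|?] := pselect (lt w0 w); [right; exists w|left; right; exists w].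
Qed.

Lemma tower_gamma_selection : gamma_selection X.
Proof.
move=> B Bop Bev.
(* [IK (n, k)] pairs an index, at least [k], of a member of the [n]-th cover with the end of a gap
   from [k] that forces points into that member. *)
have /choice[IK IKP] (nk : nat * nat) : exists IK : nat * nat,
    (nk.2 <= IK.1)%N /\
    forall x, (forall i, (nk.2 <= i < IK.2)%N -> ~~ e x i) -> B nk.1 IK.1 x.
  case: nk => n k /=.
  have [x _|N NP] := @finite_points_prefix k (B n); first exact: Bev.
  pose m := maxn N k.
  have [|K KP] := @gap_neighbourhood k (B n m).
    move=> x fx x0; apply: open_nbhs_nbhs; split; first exact: Bop.
    by apply: NP => //; apply: leq_maxl.
  by exists (m, K); split=> //=; apply: leq_maxr.
(* A gap [k, h k) is long enough for all covers numbered up to [k] at once. *)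
pose h k := (\max_(n < k.+1) (IK (n : nat, k)).2)%N.
have hP n k : (n <= k)%N -> ((IK (n, k)).2 <= h k)%N.
  by move=> nk; rewrite (bigop.bigmax_sup (Ordinal (nk : (n < k.+1)%N))).
have [w0 gaps] := tower_gaps h.
have /choice[f fP] x : exists f : nat -> nat,
    forall n i, (f n <= i)%N -> B n i x.
  by have /choice[f fP] n := Bev n x; exists f.
have [H HP] := countable_dominated f (countable_initial w0).
(* The gap starts past [n], so that [h] covers the [n]-th requirement, and past [H n], so that the
   selected index also captures the countably many initial points. *)
have /choice[k kP] n : exists k, (maxn n (H n) <= k)%N /\
    forall i, (k <= i < h k)%N -> ~~ a w0 i.
  by have [k] := gaps (maxn n (H n)); exists k.
exists (fun n => (IK (n, k n)).1) => x.
have nk n : (n <= k n)%N by have [+ _] := kP n; rewrite geq_max => /andP[].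
have Hk n : (H n <= k n)%N by have [+ _] := kP n; rewrite geq_max => /andP[].
have [/HP[N NP]|[w ww0 xw]] := initial_or_later_point w0 x.
  exists N => n /NP fH; apply: fP; apply: (leq_trans fH); apply: (leq_trans (Hk n)).
  by have [] := IKP (n, k n).
(* Beyond [M] the later set [a w] lies inside [a w0], so it keeps all gaps starting there. *)
have [[M MP] _] := tower ww0.
exists M => n Mn; have [_ /=] := IKP (n, k n); apply => i /andP[ki iK].
rewrite /e /= xw /=; have [_ gap] := kP n.
have : ~~ a w0 i by apply: gap; rewrite ki (leq_trans iK)// hP.
by apply: contra; apply: MP; apply: leq_trans ki; apply: (leq_trans Mn).
Qed.

(** The complement of [F] is open around the finite points, so it contains every point with a gap
    [k, K k). All points later than a suitable [w0] have such a gap. *)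
Lemma closed_off_finite_points_countable (F : set X) :
  closed F -> F `&` finite_points = set0 -> countable F.
Proof.
move=> clF F0.
have /choice[K KP] k : exists K,
    forall x, (forall i, (k <= i < K)%N -> ~~ e x i) -> (~` F) x.
  apply: gap_neighbourhood => x fx _; apply: open_nbhs_nbhs.
  split; first exact: closed_openC.
  by move=> Fx; have : set0 x by rewrite -F0.
have [w0 gaps] := tower_gaps K.
apply: sub_countable (countable_initial w0); apply: subset_card_le => x Fx.
have [//|[w ww0 xw]] := initial_or_later_point w0 x.
have [[M MP] _] := tower ww0; have [k Mk gap] := gaps M.
have := KP k x; case=> // i /[dup] iK /andP[ki _].
rewrite /e /= xw /=; apply: contra (gap i iK); apply: MP.
exact: leq_trans ki.
Qed.

Lemma tower_not_sigma_compact : hausdorff_space X -> ~ countable [set: X] ->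
  ~ sigma_compact X.
Proof.
move=> hX uX /(sigma_compact_uncountable uX)[K coK uK].
have einj : injective e by apply: inj_comp tower_code_inj (bij_inj phi_bij).
have [psi phiK psiK] := phi_bij.
(* [q] lists all finite points, so the closed set [F] obtained next misses them and is countable,
   although the Cantor space injects into it. *)
pose q n := psi (inl (odflt fset0 (choice.unpickle n))) : X.
have [F [clF _ Fq [g [ginj gF]]]] := perfect_subset einj enbhs q coK
  (compact_closed hX coK) uK.
have /countable_injP[c cinj] : countable F.
  apply: closed_off_finite_points_countable => //.
  rewrite -subset0 => x [Fx [s xs]]; apply: (Fq (choice.pickle s)).
  by rewrite /q choice.pickleK /= -xs phiK.
apply: uncountable_cantor; apply/countable_injP; exists (c \o g) => f f' _ _.
by move=> ff'; apply/ginj/cinj; rewrite ?inE.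
Qed.

End TowerSpace.

Theorem mainTheorem3 (R : realType) :
  exists X : metricType R,
    [/\ separable X, card_omega1 X, ~ sigma_compact X,
        Ufin (Gamma X) (Gamma X) & S1 (Gamma X) (Omega X)].
Proof.
suff [X [sepX cardX nsX selX]] : exists X : metricType R,
    [/\ separable X, card_omega1 X, ~ sigma_compact X & gamma_selection X].
  exists X; split=> //; first exact: gamma_selection_Ufin.
  exact: gamma_selection_S1.
have card_phi (T : Type) (le : rel T) (X : Type) (phi : X -> T) :
    order_type_omega1 le -> bijective phi ->
    card_omega1 X /\ ~ countable [set: X].
  move=> omega1 bphi; have XT : [set: X] #= [set: T].
    have <- : range phi = [set: T].
      have [psi phiK psiK] := bphi; apply/seteqP; split=> // t _.
      by exists (psi t); rewrite // psiK.
    by apply/card_esym/inj_card_eq => x y _ _; apply: bij_inj.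
  split; first by exists T, le.
  by rewrite (eq_countable XT); case: omega1.
have [W [le [i [iinj omega1]]]] := order_type_omega1_exists.
(* The two cases are omega_1 < b and its negation, which provides an unbounded family [f]. *)
have [dom|] := pselect (forall f : W -> nat -> nat, dominated_mod_finite f setT).
  have [X [phi [bphi nb]]] := cantor_metric R iinj.
  have [cardX uX] := card_phi _ _ _ _ omega1 bphi.
  have inj : injective (i \o phi) by apply: inj_comp iinj (bij_inj bphi).
  have domX (f : X -> nat -> nat) : dominated_mod_finite f setT.
    have [psi phiK psiK] := bphi; have [H HP] := dom (f \o psi).
    by exists H => x _; have := HP (phi x) I; rewrite /= phiK.
  exists X; split=> //.
  - exact: cylinder_separable nb.
  - exact: dominated_not_sigma_compact inj nb (@metric_hausdorff _ _) uX domX.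
  - exact: dominated_gamma_selection.
move=> /existsNP[f unb].
have [a [tower aP]] := tower_exists omega1 f.
have ainf w : infinitely_many (a w).
  by have [? /enumerates_infinite] := aP w.
have gaps := unbounded_gaps unb aP.
have [le' omega1'] := order_type_omega1_sum {fset nat} omega1.
have [X [phi [bphi nb]]] := cantor_metric R (tower_code_inj omega1 tower ainf).
have [cardX uX] := card_phi _ _ _ _ omega1' bphi.
exists X; split=> //.
- exact: cylinder_separable nb.
- have hX : hausdorff_space X by exact: metric_hausdorff.
  by have := tower_not_sigma_compact omega1 tower ainf gaps bphi nb hX uX.
- by have := tower_gamma_selection omega1 tower gaps bphi nb.
Qed.
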